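(* Let $G$ be an $n$-vertex connected graph with a cut vertex whose deletion produces a graph with $d\geq 3$ connected components such that $$d \geq \log_2 n + 1.$$ Then $G$ is not $e$-positive. In particular, if $T$ is an $n$-vertex tree with a vertex of degree $d\geq 3$ such that $d \geq \log_2 n + 1$, then $T$ is not $e$-positive.
   Context: All graphs are finite and simple. An $n$-vertex graph has exactly $n$ vertices. A cut vertex of a connected graph $G$ is a vertex $v$ such that deleting $v$ and its incident edges yields a graph with more than one connected component. Chromatic symmetric function and $e$-positivity: a proper colouring of $G$ is a map $\kappa:V_G\to\{1,2,\ldots\}$ with $\kappa(u)\neq\kappa(v)$ whenever $u,v$ are adjacent. If $V_G=\{v_1,\ldots,v_n\}$, the chromatic symmetric function is $X_G=\sum_\kappa x_{\kappa(v_1)}\cdots x_{\kappa(v_n)}\in\mathbb{Q}[[x_1,x_2,\ldots]]$, summed over all proper colourings $\kappa$ of $G$. The elementary symmetric functions are $e_i=\sum_{j_1<\cdots<j_i}x_{j_1}\cdots x_{j_i}$ for $i\ge 1$ and $e_\lambda=e_{\lambda_1}\cdots e_{\lambda_\ell}$ for a partition $\lambda=(\lambda_1,\ldots,\lambda_\ell)$; they form a basis of the algebra of symmetric functions over $\mathbb{Q}$. The graph $G$ is $e$-positive if $X_G$ is a nonnegative linear combination of the $e_\lambda$. *)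

(* Defs.v *)
From mathcomp Require Export all_boot all_order all_algebra finmap.
From mathcomp Require Export boolp classical_sets functions cardinality.
From mathcomp Require Export fsbigop reals exp.
From mathcomp Require Export monalg.

Set Implicit Arguments.
Unset Strict Implicit.
Unset Printing Implicit Defensive.

Import Order.TTheory GRing.Theory Num.Theory.

Local Open Scope classical_set_scope.
Local Open Scope ring_scope.

Record sgraph := SGraph {
  vertex :> finType;
  adj : rel vertex;
  adj_sym : symmetric adj;
  adj_irrefl : irreflexive adj
}.
Arguments adj {s}.

Section DeleteVertex.
Variables (G : sgraph) (v : G).

Let V' : finType := {x : G | x != v}.
Let adj' : rel V' := fun x y => adj (val x) (val y).

Fact delete_vertex_sym : symmetric adj'.
Proof. by move=> x y; apply: adj_sym. Qed.

Fact delete_vertex_irrefl : irreflexive adj'.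
Proof. by move=> x; apply: adj_irrefl. Qed.

Definition delete_vertex : sgraph :=
  SGraph delete_vertex_sym delete_vertex_irrefl.

End DeleteVertex.

Definition n_components (G : sgraph) : nat := n_comp (@adj G) predT.

Definition is_connected (G : sgraph) : Prop := n_components G = 1%N.

Definition is_cut_vertex (G : sgraph) (v : G) : Prop :=
  (1 < n_components (delete_vertex v))%N.

Definition degree (G : sgraph) (v : G) : nat := #|[set u | adj v u]%SET|.

(* For a symmetric relation, [ucycle] also accepts an edge traversed back and
   forth as a cycle of size 2; graph cycles are those of size at least 3. *)
Definition is_acyclic (G : sgraph) : Prop :=
  forall c : seq G, ucycle adj c -> (size c <= 2)%N.

Definition is_tree (G : sgraph) : Prop := is_connected G /\ is_acyclic G.

(* Q[[x_0, x_1, ...]]: a power series is its family of coefficients, indexed by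
   the monomials in the variables x_i, i : nat; x_i is [ucm i].  Variables, and
   hence colours, are numbered from 0 rather than from 1. *)
Definition fps : Type := {cmonom nat} -> rat.

(* The formal sum of the monomials [f i] over the possibly infinite set P of
   indices.  A sum [\sum_(i \in A)] is 0 by convention when A is infinite, so
   each coefficient is meaningful when f takes each value finitely often on P;
   see [finite_colouring_fiber] and [finite_fset_fiber] below, and
   [finite_mul_fiber] for the Cauchy product [fps_mul]. *)
Definition monomial_sum (I : choiceType) (P : set I) (f : I -> {cmonom nat}) :
  fps := fun m => \sum_(i \in [set i | P i /\ f i = m]) (1 : rat).

Definition fps_one : fps := fun m => (m == mone)%:R.

Definition fps_mul (F H : fps) : fps := fun m =>
  \sum_(p \in [set p : {cmonom nat} * {cmonom nat} | mmul p.1 p.2 = m])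
    F p.1 * H p.2.

Definition proper_colouring (G : sgraph) (k : {ffun G -> nat}) : Prop :=
  forall u v : G, adj u v -> k u <> k v.

Definition colouring_monomial (V : finType) (k : {ffun V -> nat}) :
  {cmonom nat} := \big[mmul/mone]_(v : V) ucm (k v).

Definition chromatic_fps (G : sgraph) : fps :=
  monomial_sum [set k | proper_colouring k] (@colouring_monomial G).

Definition fset_monomial (J : {fset nat}) : {cmonom nat} :=
  \big[mmul/mone]_(j <- J) ucm j.

(* The index j_1 < ... < j_i is encoded as the i-element set {j_1, ..., j_i}. *)
Definition elem_fps (i : nat) : fps :=
  monomial_sum [set J : {fset nat} | #|` J| = i] fset_monomial.

Definition is_partition (la : seq nat) : Prop :=
  sorted geq la /\ 0%N \notin la.

Definition elem_part_fps (la : seq nat) : fps :=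
  \big[fps_mul/fps_one]_(i <- la) elem_fps i.

Definition e_positive (G : sgraph) : Prop :=
  exists (S : seq (seq nat)) (c : seq nat -> rat),
    [/\ uniq S,
        forall la, la \in S -> is_partition la /\ 0 <= c la
      & forall m, chromatic_fps G m = \sum_(la <- S) c la * elem_part_fps la m].

Definition log2 (R : realType) (x : R) : R := ln x / ln 2.

Section Finiteness.
Implicit Types m : {cmonom nat}.

Lemma cm_big (I : Type) (r : seq I) (f : I -> {cmonom nat}) (j : nat) :
  (\big[mmul/mone]_(i <- r) f i) j = (\sum_(i <- r) f i j)%N.
Proof.
elim: r => [|i r IHr]; first by rewrite !big_nil cm1.
by rewrite !big_cons cmM IHr.
Qed.

Lemma finite_colouring_fiber (V : finType) m :
  finite_set [set k : {ffun V -> nat} | colouring_monomial k = m].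
Proof.
pose g (h : {ffun V -> finsupp m}) : {ffun V -> nat} := [ffun v => val (h v)].
apply: (@sub_finite_set _ _ (g @` setT)); last first.
  exact/finite_image/finite_finset.
move=> k /= km.
have kin v : k v \in finsupp m.
  rewrite mem_finsupp -km /colouring_monomial cm_big (bigD1 v) //= cmUU.
  by rewrite addn_eq0.
exists [ffun v => [` kin v]%fset] => //.
by apply/ffunP => v; rewrite !ffunE.
Qed.

Lemma finite_fset_fiber m :
  finite_set [set J : {fset nat} | fset_monomial J = m].
Proof.
apply: (@sub_finite_set _ _ [set` fpowerset (finsupp m)]); last first.
  exact: finite_fset.
move=> J /= Jm; rewrite fpowersetE; apply/fsubsetP => j jJ.
rewrite mem_finsupp -Jm /fset_monomial cm_big (big_fsetD1 j) //= cmUU.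
by rewrite addn_eq0.
Qed.

Lemma finite_mul_fiber m :
  finite_set [set p : {cmonom nat} * {cmonom nat} | mmul p.1 p.2 = m].
Proof.
pose T : finType := {ffun finsupp m -> 'I_(mdeg m).+1}.
pose g (h : T) : {cmonom nat} :=
  \big[mmul/mone]_(i : finsupp m) iter (h i) (mmul (ucm (val i))) mone.
pose B := g @` setT.
have finB : finite_set B by exact/finite_image/finite_finset.
apply: (@sub_finite_set _ _ (B `*` B)); last exact: finite_setX.
suff sub a b : mmul a b = m -> B a.
  move=> [a b] /= abm; split; first exact: sub abm.
  by apply: (sub b a); rewrite mulmC.
move=> abm.
have le_am i : (a i <= m i)%N by rewrite -abm cmM leq_addr.
have le_mdeg i : (m i <= mdeg m)%N.
  have [im|] := boolP (i \in finsupp m); last by move/fsfun_dflt ->.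
  by rewrite mdegE (big_fsetD1 i) //= leq_addr.
exists [ffun i : finsupp m => inord (a (val i))] => //.
apply/eqP/cmP => j; rewrite cm_big.
have E (i : finsupp m) :
  (iter ([ffun i : finsupp m => inord (a (val i))] i : 'I_(mdeg m).+1)
     (mmul (ucm (val i))) mone : {cmonom nat}) j
    = (a (val i) * (val i == j))%N.
  rewrite ffunE inordK ?ltnS ?(leq_trans (le_am _)) //.
  elim: (a (val i)) => [|n IHn]; first by rewrite /= cm1.
  by rewrite iterS cmM IHn cmU mulSn.
rewrite (eq_bigr _ (fun i _ => E i)).
have [jm|jm] := boolP (j \in finsupp m).
  rewrite (bigD1 [` jm]%fset) //= eqxx muln1 big1 ?addn0 // => i ne.
  rewrite [_ == j](negbTE _) ?muln0 //;
    by apply: contra ne => /eqP ij; apply/eqP/val_inj.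
have -> : a j = 0%N.
  by apply/eqP; rewrite -leqn0 (leq_trans (le_am j)) // (fsfun_dflt jm).
rewrite big1 // => i _; have [ij|_] := eqVneq (val i) j; last by rewrite muln0.
by move: jm; rewrite -ij (fsvalP i).
Qed.

End Finiteness.

(* Main.v *)
Require Import Defs.
From mathcomp Require Import algC cyclotomic.

(** The proof shows that a connected [e]-positive graph can be cut into connected
    pieces of any prescribed sizes (a theorem of Wolfgang), and that a vertex
    whose deletion leaves many components makes some sizes impossible.

    For the first part, write [X_G] as the sum of the [c la * e_la] and
    specialize the variables. Given block sizes [mu i] with sum [n = #|G|], use
    [mu i] colours for block [i], evaluate them at the [mu i]-th roots of unity
    times a block variable [t_i] (times a constant that takes care of signs), and
    extract the coefficient of the product of the [t_i ^ mu i].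
    - By the factorization of ['X^k - 1], the elementary symmetric polynomials
      become sums of products of the [t_i ^ mu i] with coefficients [0] and [1],
      so every [e_la] contributes nonnegatively, and [e_n] contributes
      positively ([elem_lettersE]).
    - [X_G] becomes a sum over the colourings that use the colours of block [i]
      exactly [mu i] times. If a block occupies a disconnected set, then rotating
      its colours on a union of components multiplies the terms by a root of
      unity other than [1], so these colourings cancel ([sum_recolour_eq0]).
    With a single block only [e_n] survives, and a deletion-contraction argument
    shows that the colouring sum is positive ([signed_weight_pos]); hence the
    coefficient of [e_n] is positive. For arbitrary [mu] the coefficient is then
    positive as well, so the colouring sum is not [0] and a connected partition
    with block sizes [mu] exists ([e_positive_connected_partition]).

    For the second part, let [v] be a vertex and [x] a component of [G - v], and
    partition [G] into connected parts of size [#|x| + 1] and at most one smaller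
    part. Every component with at most [#|x|] vertices lies in the part of [v],
    with at most one exception, so these components have at most [#|x|] vertices
    in total ([e_positive_component_sizes]). Taken by increasing size, each
    component is therefore at least as large as the previous ones together: [d]
    components have at least [2 ^ (d - 1)] vertices in total ([exp_leq_sum]), and
    [n > 2 ^ (d - 1)], that is, [d < log2 n + 1]. In a tree the components of
    [T - v] are at least as many as the neighbours of [v]. *)

Set Implicit Arguments.
Unset Strict Implicit.
Unset Printing Implicit Defensive.

Import Order.TTheory GRing.Theory Num.Theory.

Local Open Scope ring_scope.

(** * Specializing the variables of a power series *)

Section Specialization.

Variables (A : comNzRingType) (iota : {rmorphism rat -> A}).
Variable (g : {cmonom nat} -> A).
Hypothesis g1 : g mone = 1.
Hypothesis gM : forall m1 m2, g (mmul m1 m2) = g m1 * g m2.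

(** A relation rather than a function: an arbitrary power series has a value under
    the substitution [g] only if finitely many of its terms survive it, and [X]
    lists monomials outside of which they vanish. *)
Definition evaluates (F : fps) (a : A) : Prop :=
  exists X : {fset {cmonom nat}},
    (forall m, m \notin X -> iota (F m) * g m = 0) /\
    a = \sum_(m <- X) iota (F m) * g m.

Lemma evaluates_fsbig (F : fps) a :
  evaluates F a -> a = \sum_(m \in setT) iota (F m) * g m.
Proof. by case=> X [X0 ->]; rewrite (fsbigTE X). Qed.

Lemma evaluates_inj (F : fps) a b : evaluates F a -> evaluates F b -> a = b.
Proof. by move=> /evaluates_fsbig -> /evaluates_fsbig ->. Qed.

Lemma eq_evaluates (F H : fps) a : F =1 H -> evaluates F a -> evaluates H a.
Proof.
move=> FH [X [X0 ->]]; exists X; split=> [m mX|]; first by rewrite -FH X0.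
by apply: eq_bigr => m _; rewrite FH.
Qed.

(** Two values can be added once their terms are listed over a common set. *)
Lemma evaluates_widen (F : fps) a (Y : {fset {cmonom nat}}) :
    evaluates F a ->
  exists X : {fset {cmonom nat}}, [/\ (Y `<=` X)%fset,
    forall m, m \notin X -> iota (F m) * g m = 0 &
    a = \sum_(m <- X) iota (F m) * g m].
Proof.
case=> X [X0 ->]; exists (X `|` Y)%fset; split; first exact: fsubsetUr.
  by move=> m; rewrite inE negb_or => /andP[/X0].
by apply: big_fset_incl; [exact: fsubsetUl|move=> m _ /X0].
Qed.

Lemma evaluates_linear_comb (S : seq (seq nat)) (c : seq nat -> rat)
    (F : seq nat -> fps) (a : seq nat -> A) :
    (forall la, evaluates (F la) (a la)) ->
  evaluates (fun m => \sum_(la <- S) c la * F la m)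
    (\sum_(la <- S) iota (c la) * a la).
Proof.
move=> Fa; elim: S => [|la S [X [X0 E]]].
  exists fset0; split=> [m _|]; first by rewrite big_nil rmorph0 mul0r.
  by rewrite !big_nil.
have [Y [XY Y0 Ea]] := evaluates_widen X (Fa la).
have Xout m : m \notin Y -> m \notin X.
  by apply: contra => mX; apply: (fsubsetP XY).
exists Y; split=> [m mY|].
  by rewrite big_cons rmorphD rmorphM mulrDl -mulrA Y0 // mulr0 X0 ?addr0 ?Xout.
rewrite big_cons E (big_fset_incl _ XY); last by move=> m _ /X0.
rewrite Ea mulr_sumr -big_split /=; apply: eq_bigr => m _.
by rewrite big_cons rmorphD rmorphM mulrDl mulrA.
Qed.

Lemma evaluates_one : evaluates fps_one 1.
Proof.
exists [fset mone]%fset; split=> [m|].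
  by rewrite in_fset1 => /negbTE mN1; rewrite /fps_one mN1 rmorph0 mul0r.
by rewrite big_seq_fset1 /fps_one eqxx rmorph1 g1 mulr1.
Qed.

(** Multiplicativity of [g] turns each term of the Cauchy product into a product
    of terms of the factors; grouping the pairs of monomials by their product
    recovers the product of the two values. *)
Lemma evaluates_mul (F H : fps) a b :
  evaluates F a -> evaluates H b -> evaluates (fps_mul F H) (a * b).
Proof.
case=> X [X0 ->] [Y [Y0 ->]].
pose s := [seq (x, y) | x <- X, y <- Y].
pose T (p : {cmonom nat} * {cmonom nat}) :=
  (iota (F p.1) * g p.1) * (iota (H p.2) * g p.2).
have us : uniq s.
  by apply: allpairs_uniq; rewrite ?fset_uniq // => -[? ?] [? ?].
have TE m : iota (fps_mul F H m) * g m = \sum_(p <- s | mmul p.1 p.2 == m) T p.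
  rewrite /fps_mul fsbig_finite; last exact: finite_mul_fiber.
  rewrite rmorph_sum mulr_suml.
  rewrite (eq_big_seq T) => [|p]; last first.
    rewrite in_fset_set; last exact: finite_mul_fiber.
    by rewrite inE /= => <-; rewrite gM rmorphM mulrACA.
  rewrite -fsbig_finite; last exact: finite_mul_fiber.
  rewrite (fsbigE [seq p <- s | mmul p.1 p.2 == m]).
  - rewrite big_filter_cond; apply: eq_bigl => p.
    by rewrite andb_idr // => /eqP pm; apply: mem_set.
  - exact: filter_uniq.
  - by move=> p; rewrite /= mem_filter => /andP[/eqP].
  move=> p /= pm; rewrite mem_filter pm eqxx /=; case: p {pm} => x y xyP.
  rewrite /T /=; have [xX|/X0 ->] := boolP (x \in X); last by rewrite mul0r.
  have [yY|/Y0 ->] := boolP (y \in Y); last by rewrite mulr0.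
  by case/negP: xyP; apply: allpairs_f.
pose Z := [fset mmul p.1 p.2 | p in s]%fset.
exists Z; split=> [m mZ|].
  rewrite TE big_seq_cond big1 // => p /andP[ps /eqP pm].
  by case/negP: mZ; apply/imfsetP; exists p.
under [RHS]eq_bigr => m _ do rewrite TE big_mkcond.
rewrite exchange_big /= big_distrlr /= -(big_allpairs (F := T)) /=.
apply: eq_big_seq => p ps; rewrite -big_mkcond /=.
rewrite (eq_bigl (xpred1 (mmul p.1 p.2))); last by move=> m; rewrite eq_sym.
rewrite -big_filter filter_pred1_uniq ?fset_uniq ?big_seq1 //.
by apply/imfsetP; exists p.
Qed.

Lemma evaluates_prod (F : nat -> fps) (a : nat -> A) (la : seq nat) :
    (forall j, evaluates (F j) (a j)) ->
  evaluates (\big[fps_mul/fps_one]_(j <- la) F j) (\prod_(j <- la) a j).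
Proof.
move=> Fa; elim: la => [|j la IH].
  by rewrite !big_nil; exact: evaluates_one.
by rewrite !big_cons; apply: evaluates_mul.
Qed.

(** Finite fibers make the coefficients of the formal sum equal to the numbers of
    indices of each monomial, so that its value is the sum over all indices; [s]
    lists those whose monomial survives the substitution. *)
Lemma evaluates_monomial_sum (I : choiceType) (P : set I)
    (f : I -> {cmonom nat}) (s : seq I) :
    (forall m, finite_set [set i | f i = m]%classic) -> uniq s ->
    (forall i, i \in s -> P i) ->
    (forall i, P i -> i \notin s -> g (f i) = 0) ->
  evaluates (monomial_sum P f) (\sum_(i <- s) g (f i)).
Proof.
move=> finf us sP s0.
have fin m : finite_set [set i | P i /\ f i = m]%classic.
  by apply: sub_finite_set (finf m) => i /= [].
have E m : iota (monomial_sum P f m) * g m = \sum_(i <- s | f i == m) g (f i).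
  rewrite /monomial_sum fsbig_finite // rmorph_sum mulr_suml.
  rewrite (eq_big_seq (g \o f)) => [|i]; last first.
    by rewrite in_fset_set // inE /= => -[_ <-]; rewrite rmorph1 mul1r.
  rewrite -fsbig_finite // (fsbigE [seq i <- s | f i == m]).
  - rewrite big_filter_cond big_seq_cond [RHS]big_seq_cond.
    apply: eq_bigl => i; case: (boolP (i \in s)) => //= si.
    by rewrite andb_idr // => /eqP fi; apply: mem_set; split; first exact: sP.
  - exact: filter_uniq.
  - by move=> i /=; rewrite mem_filter => /andP[/eqP fi /sP].
  by move=> i [Pi fi]; rewrite mem_filter fi eqxx /= => /(s0 _ Pi).
pose X := [fset f i | i in s]%fset.
exists X; split=> [m mX|].
  rewrite E big_seq_cond big1 // => i /andP[si /eqP fi].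
  by case/negP: mX; apply/imfsetP; exists i.
under [RHS]eq_bigr => m _ do rewrite E big_mkcond.
rewrite exchange_big /=; apply: eq_big_seq => i si; rewrite -big_mkcond /=.
rewrite (eq_bigl (xpred1 (f i))); last by move=> m; rewrite eq_sym.
rewrite -big_filter filter_pred1_uniq ?fset_uniq ?big_seq1 //.
by apply/imfsetP; exists i.
Qed.

End Specialization.

Definition properb (V : finType) (C : eqType) (e : rel V) (k : V -> C) : bool :=
  [forall u, forall v, e u v ==> (k u != k v)].

Lemma properbP (V : finType) (C : eqType) (e : rel V) (k : V -> C) :
  reflect (forall u v, e u v -> k u != k v) (properb e k).
Proof.
by apply: (iffP 'forall_'forall_implyP) => kP u v; apply: kP.
Qed.

Section FiniteSpecialization.

Variables (A : comNzRingType) (iota : {rmorphism rat -> A}).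
Variables (C : finType) (y : C -> A).

(** The variables [x_j] with [j < #|C|] are identified with the elements of [C];
    all the others are set to [0]. *)
Let var (j : nat) : A :=
  if insub j is Some i then y (@enum_val C predT i) else 0.

Let code (c : C) : nat := enum_rank c.

Let var_code c : var (code c) = y c.
Proof. by rewrite /var /code valK enum_rankK. Qed.

Let code_inj : injective code.
Proof. by move=> c c' /val_inj /enum_rank_inj. Qed.

Let var_out j : (forall c, code c != j) -> var j = 0.
Proof.
rewrite /var; case: insubP => // i _ <- /(_ (enum_val i)).
by rewrite /code enum_valK eqxx.
Qed.

Let spec (m : {cmonom nat}) : A := \prod_(j <- finsupp m) var j ^+ m j.

Let specE (m : {cmonom nat}) (X : {fset nat}) :
  (finsupp m `<=` X)%fset -> spec m = \prod_(j <- X) var j ^+ m j.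
Proof.
by move=> mX; apply: big_fset_incl => // j _ /fsfun_dflt ->.
Qed.

Let spec1 : spec mone = 1.
Proof. by rewrite /spec mdom1 big_seq_fset0. Qed.

Let specM m1 m2 : spec (mmul m1 m2) = spec m1 * spec m2.
Proof.
rewrite (specE (X := (finsupp m1 `|` finsupp m2)%fset)); last by rewrite mdomD.
rewrite (specE (fsubsetUl (finsupp m1) (finsupp m2))).
rewrite (specE (fsubsetUr (finsupp m1) (finsupp m2))) -big_split.
by apply: eq_bigr => j _; rewrite cmM exprD.
Qed.

Let specU j : spec (ucm j) = var j.
Proof. by rewrite /spec mdomU big_seq_fset1 cmUU. Qed.

Let spec_prod (I : Type) (r : seq I) (f : I -> nat) :
  spec (\big[mmul/mone]_(i <- r) ucm (f i)) = \prod_(i <- r) var (f i).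
Proof.
elim: r => [|i r IH]; first by rewrite !big_nil.
by rewrite !big_cons specM specU IH.
Qed.

Let spec_chromatic (G : sgraph) :
  evaluates iota spec (chromatic_fps G)
    (\sum_(k : {ffun G -> C} | properb adj k) \prod_v y (k v)).
Proof.
pose enc (k : {ffun G -> C}) := [ffun v => code (k v)].
have enc_inj : injective enc.
  move=> k k' /ffunP E; apply/ffunP => v; apply: code_inj.
  by have := E v; rewrite !ffunE.
pose s := [seq enc k | k : {ffun G -> C} <-
  enum (fun k : {ffun G -> C} => properb adj k)].
have -> : \sum_(k : {ffun G -> C} | properb adj k) \prod_v y (k v)
          = \sum_(k <- s) spec (colouring_monomial k).
  rewrite big_map big_enum_cond /=; apply: eq_big => [k|k _].
    by rewrite andbT.
  by rewrite spec_prod; apply: eq_bigr => v _; rewrite ffunE var_code.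
apply: evaluates_monomial_sum.
- exact: finite_colouring_fiber.
- by rewrite map_inj_uniq ?enum_uniq.
- move=> _ /mapP[k + ->]; rewrite mem_enum => /properbP kP u v /kP kuv.
  by rewrite !ffunE => /code_inj E; rewrite E eqxx in kuv.
move=> k kP kNs; rewrite spec_prod.
have [v vN] : exists v, var (k v) = 0; last by rewrite (bigD1 v) //= vN mul0r.
apply/not_existsP => kN; case/negP: kNs.
have kC v : exists c, code c == k v.
  apply: contrapT => /forallNP vN; apply: (kN v); apply: var_out => c.
  exact/negP/vN.
pose k' : {ffun G -> C} := [ffun v => xchoose (kC v)].
have kk' : k = enc k'.
  by apply/ffunP => v; rewrite !ffunE; apply/esym/eqP/(xchooseP (kC v)).
rewrite kk'; apply: map_f; rewrite mem_enum; apply/properbP => u v /kP.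
by rewrite kk' !ffunE => kuv; apply/eqP => E; rewrite E in kuv.
Qed.

Let spec_elem (i : nat) :
  evaluates iota spec (elem_fps i)
    (\sum_(J : {set C} | #|J| == i) \prod_(c in J) y c).
Proof.
pose enc (J : {set C}) : {fset nat} := [fset code c | c in J]%fset.
have enc_mem J c : (code c \in enc J) = (c \in J).
  by rewrite mem_imfset.
have enc_inj : injective enc.
  by move=> J J' E; apply/setP => c; rewrite -!enc_mem E.
have card_enc J : #|` enc J| = #|J|.
  by rewrite card_imfset //= -cardE.
pose s := [seq enc J | J : {set C} <- enum (fun J : {set C} => #|J| == i)].
have -> : \sum_(J : {set C} | #|J| == i) \prod_(c in J) y c
          = \sum_(J <- s) spec (fset_monomial J).
  rewrite big_map big_enum_cond /=; apply: eq_big => [J|J _].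
    by rewrite andbT.
  rewrite spec_prod big_imfset /=; last by move=> c c' _ _ /code_inj.
  by rewrite big_enum; apply: eq_bigr => c _; rewrite var_code.
apply: evaluates_monomial_sum.
- exact: finite_fset_fiber.
- by rewrite map_inj_uniq ?enum_uniq.
- by move=> _ /mapP[J + ->]; rewrite mem_enum /= card_enc => /eqP.
move=> J /= cJ JNs; rewrite spec_prod.
have [j jJ j0] : exists2 j, j \in J & var j = 0.
  apply: contrapT => JN; case/negP: JNs.
  have JE : J = enc [set c | code c \in J].
    apply/fsetP => j; apply/idP/imfsetP => [jJ|[c /= + ->]];
      last by rewrite inE.
    have [c /eqP cj] : exists c, code c == j.
      apply: contrapT => /forallNP jN; apply: JN; exists j => //.
      by apply: var_out => c; exact/negP/jN.
    by exists c; rewrite /= ?inE cj.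
  by rewrite JE; apply: map_f; rewrite mem_enum /in_mem /= -card_enc -JE cJ.
by rewrite (big_fsetD1 j) //= j0 mul0r.
Qed.

(** Equating the values of the two sides of an [e]-expansion leaves an identity
    between finite sums: proper colourings with colours in [C] on the left, and
    elementary symmetric polynomials in the family [y] on the right. *)
Lemma chromatic_elem_specialization (G : sgraph) (S : seq (seq nat))
    (c : seq nat -> rat) :
    (forall m, chromatic_fps G m = \sum_(la <- S) c la * elem_part_fps la m) ->
  \sum_(k : {ffun G -> C} | properb adj k) \prod_v y (k v) =
  \sum_(la <- S) iota (c la) *
     \prod_(j <- la) \sum_(J : {set C} | #|J| == j) \prod_(x in J) y x.
Proof.
move=> GE; apply: evaluates_inj (spec_chromatic G) _.
apply: (@eq_evaluates _ _ _
  (fun m => \sum_(la <- S) c la * elem_part_fps la m)).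
  by move=> m; rewrite GE.
apply: evaluates_linear_comb => la.
by apply: (evaluates_prod spec1 specM); exact: spec_elem.
Qed.

End FiniteSpecialization.

(** * Colourings by roots of unity *)

Section Recolouring.

Variables (V C : finType) (B : {set V}) (s : C -> C).

Definition recolour (k : {ffun V -> C}) : {ffun V -> C} :=
  [ffun v => if v \in B then s (k v) else k v].

Lemma recolour_inj : injective s -> injective recolour.
Proof.
move=> s_inj k k' /ffunP E; apply/ffunP => v.
by have := E v; rewrite !ffunE; case: ifP => // _ /s_inj.
Qed.

(** Edges inside [B] are safe because [s] is injective; for an edge that leaves
    [B], the class [P] keeps the colours of its ends apart before and after. *)
Lemma recolour_proper (P : pred C) (e : rel V) (k : {ffun V -> C}) :
    injective s -> (forall c, P (s c) = P c) ->
    (forall v, v \in B -> P (k v)) ->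
    (forall u v, e u v -> (u \in B) != (v \in B) -> P (k u) != P (k v)) ->
  properb e (recolour k) = properb e k.
Proof.
move=> s_inj Ps PB PnB.
suff E u v : e u v -> (recolour k u == recolour k v) = (k u == k v).
  by apply/properbP/properbP => kP u v euv; move: (kP u v euv); rewrite E.
move=> euv; rewrite !ffunE; have := PnB u v euv.
case: ifP => uB; case: ifP => vB; rewrite ?(inj_eq s_inj) //= => /(_ isT) D.
  have /negbTE-> : s (k u) != k v.
    by apply: contra D => /eqP <-; rewrite Ps.
  by apply/esym/negbTE; apply: contra D => /eqP ->.
have /negbTE-> : k u != s (k v).
  by apply: contra D => /eqP ->; rewrite Ps.
by apply/esym/negbTE; apply: contra D => /eqP ->.
Qed.

(** Recolouring permutes the colourings of the sum and multiplies every term by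
    [w ^+ #|B|], so that the sum is a multiple of itself by a factor other than
    [1]. *)
Lemma sum_recolour_eq0 (K : idomainType) (z : C -> K) (w : K) (P : pred C)
    (Q : pred {ffun V -> C}) :
    injective s -> (forall c, P c -> z (s c) = w * z c) ->
    (forall k, Q k -> forall v, v \in B -> P (k v)) ->
    (forall k, Q (recolour k) = Q k) -> w ^+ #|B| != 1 ->
  \sum_(k | Q k) \prod_v z (k v) = 0.
Proof.
move=> s_inj zs QP Qs wB; set S := LHS.
suff : S = w ^+ #|B| * S.
  move/eqP; rewrite -subr_eq0 -{1}[S]mul1r -mulrBl mulf_eq0 subr_eq0 eq_sym.
  by rewrite (negbTE wB) => /eqP.
rewrite {1}/S (reindex_inj (recolour_inj s_inj)) (eq_bigl _ _ Qs) mulr_sumr.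
apply: eq_bigr => k /QP kP.
rewrite -prodr_const (big_mkcond (fun v => v \in B)) -big_split /=.
apply: eq_bigr => v _; rewrite ffunE.
by case: ifP => [/kP/zs|_] //; rewrite mul1r.
Qed.

End Recolouring.

Section RootOfUnityColourings.

Variables (V C : finType) (s : C -> C) (z : C -> algC) (w : algC).
Hypothesis s_inj : injective s.
Hypothesis z_s : forall c, z (s c) = w * z c.
Hypothesis w_prim : forall j, (0 < j < #|V|)%N -> w ^+ j != 1.
Hypothesis z_pow : forall c, z c ^+ #|V| = (-1) ^+ #|V|.+1.
Hypothesis C_gt0 : (0 < #|C|)%N.

(** Colourings that are constant on [A] stand for the colourings of the graph in
    which [A] is contracted to a single vertex. *)
Definition constant_on (A : {set V}) (k : V -> C) : bool :=
  [forall a in A, forall b in A, k a == k b].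

Lemma constant_onP (A : {set V}) (k : V -> C) :
  reflect {in A &, forall a b, k a = k b} (constant_on A k).
Proof.
apply: (iffP 'forall_in_'forall_in_eqP) => kP a b.
  by move=> aA bA; exact: kP.
by move=> bA; exact: kP.
Qed.

Let weight (A : {set V}) (e : rel V) : algC :=
  \sum_(k : {ffun V -> C} | constant_on A k && properb e k) \prod_v z (k v).

(** Connectedness of the graph with edges [e] and with [A] contracted. *)
Let connects (A : {set V}) (e : rel V) : Prop :=
  forall B : {set V}, A \subset B -> B != [set: V] ->
    exists x y, [/\ x \in B, y \notin B & e x y].

(** When no edge leaves [A], rotating the colour of [A] preserves properness and
    makes the weight vanish, unless [A] contains all vertices: then only the
    constant colourings remain, each contributing [z c ^+ #|V|]. *)
Let weight_isolated (A : {set V}) (e : rel V) a0 :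
    a0 \in A -> {in A &, forall a b, ~~ e a b} ->
    (forall u v, e u v -> (u \in A) = (v \in A)) ->
  weight A e = (A == [set: V])%:R * (#|C|%:R * (-1) ^+ #|V|.+1).
Proof.
move=> a0A eA eAC; have [AT|AT] := eqVneq A [set: V]; last first.
  rewrite mul0r /weight; apply: (sum_recolour_eq0 (B := A) (P := predT) s_inj).
  - by move=> c _; exact: z_s.
  - by [].
  - move=> k; congr andb; last first.
      apply: (recolour_proper (P := predT)) => // u v /eAC ->.
      by rewrite eqxx.
    apply/constant_onP/constant_onP => kA a b aA bA; have := kA a b aA bA.
      by rewrite !ffunE aA bA => /s_inj.
    by rewrite !ffunE aA bA => ->.
  apply: w_prim; rewrite card_gt0; apply/andP; split.
    by apply/set0Pn; exists a0.
  by rewrite -cardsT proper_card // finset.properEneq AT finset.subsetT.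
have cst (k : {ffun V -> C}) :
    constant_on A k && properb e k = (k == [ffun=> k a0]).
  apply/andP/eqP => [[/constant_onP kA _]|->].
    by apply/ffunP => v; rewrite ffunE; apply: kA; rewrite // AT inE.
  split; first by apply/constant_onP => a b _ _; rewrite !ffunE.
  apply/properbP => u v euv; have := eA u v.
  by rewrite AT !inE euv => /(_ isT isT).
rewrite mul1r /weight (eq_bigl _ _ cst).
rewrite (reindex_onto (fun c : C => [ffun=> c])
  (fun k : {ffun V -> C} => k a0)) /=.
  rewrite mulr_natl -sumr_const; apply: eq_big => [c|c _].
    by rewrite !ffunE !eqxx.
  rewrite -(z_pow c) -prodr_const; apply: eq_bigr => v _.
  by rewrite ffunE.
by move=> k /eqP {2}->.
Qed.

Let signed_weight_isolated (A : {set V}) (e : rel V) a0 :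
    a0 \in A -> {in A &, forall a b, ~~ e a b} ->
    (forall u v, e u v -> (u \in A) = (v \in A)) ->
  0 <= (-1) ^+ #|A|.+1 * weight A e /\
  (connects A e -> 0 < (-1) ^+ #|A|.+1 * weight A e).
Proof.
move=> a0A eA eAC; rewrite (weight_isolated a0A eA eAC).
have [AT|AT] := eqVneq A [set: V]; last first.
  rewrite mul0r mulr0; split=> // /(_ A (subxx _) AT)[x [v [xA vA /eAC]]].
  by rewrite xA (negbTE vA).
suff pos : 0 < (-1) ^+ #|A|.+1 * (1 * (#|C|%:R * (-1) ^+ #|V|.+1)) :> algC.
  by split=> [|_] //; exact: ltW.
by rewrite mul1r mulrCA AT cardsT -expr2 sqrr_sign mulr1 ltr0n.
Qed.

(** Deletion-contraction. Some vertex [u] outside [A] is adjacent to [A], and all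
    edges between [A] and [u] are treated at once: the colourings in which [u] and
    [A] differ are those of the graph without these edges, minus those in which
    [u] has joined [A]. Contraction therefore never creates a loop; it flips the
    sign and preserves connectedness, while deletion contributes a nonnegative
    term. *)
Lemma signed_weight_pos m (A : {set V}) (e : rel V) a0 :
    (#|[set p | e p.1 p.2]| <= m)%N -> symmetric e -> irreflexive e ->
    a0 \in A -> {in A &, forall a b, ~~ e a b} ->
  0 <= (-1) ^+ #|A|.+1 * weight A e /\
  (connects A e -> 0 < (-1) ^+ #|A|.+1 * weight A e).
Proof.
elim: m A e => [|m IH] A e em es ei a0A eA.
  apply: (signed_weight_isolated a0A eA) => u v euv.
  move: em; rewrite leqn0 cards_eq0 => /eqP/setP/(_ (u, v)).
  by rewrite !inE euv.
have [/existsP[a /existsP[u /and3P[aA uA eau]]]|noedge] :=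
    boolP [exists a, exists u, [&& a \in A, u \notin A & e a u]]; last first.
  apply: (signed_weight_isolated a0A eA) => u v euv; apply/idP/idP.
    move=> uA; move/existsPn/(_ u)/existsPn/(_ v): noedge.
    by rewrite uA euv andbT negbK.
  move=> vA; move/existsPn/(_ v)/existsPn/(_ u): noedge.
  by rewrite vA es euv andbT negbK.
pose e' := [rel x v | e x v &&
  ~~ ((x \in A) && (v == u) || (x == u) && (v \in A))].
have e's : symmetric e'.
  by move=> x v; rewrite /= es orbC; congr (_ && ~~ (_ || _)); exact: andbC.
have e'i : irreflexive e' by move=> x; rewrite /= ei.
have e'm : (#|[set p | e' p.1 p.2]| <= m)%N.
  rewrite -ltnS; apply: leq_trans em; apply: proper_card; apply/properP; split.
    by apply/fintype.subsetP => p; rewrite !inE => /andP[].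
  by exists (a, u); rewrite !inE ?eau //= aA eqxx.
(* The deleted edges amount to the single condition k u != k a0. *)
have E : weight A e = weight A e' - weight (u |: A) e'.
  apply/eqP; rewrite eq_sym subr_eq /weight; apply/eqP.
  rewrite (bigID (fun k : {ffun V -> C} => k u == k a0)) /= addrC.
  congr (_ + _).
    apply: eq_bigl => k; rewrite -andbA; apply: andb_id2l => /constant_onP kA.
    apply/andP/properbP => [[/properbP kP kua]|kP].
      move=> x v exv; have [|] := boolP (e' x v); first exact: kP.
      rewrite /= exv /= negbK => /orP[/andP[xA /eqP->]|/andP[/eqP-> vA]].
        by rewrite (kA _ _ xA a0A) eq_sym.
      by rewrite (kA _ _ vA a0A).
    split; first by apply/properbP => x v /andP[/kP].
    by rewrite -(kA _ _ aA a0A) eq_sym; exact: kP.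
  apply: eq_bigl => k; rewrite -andbA [X in _ && X]andbC andbA; congr (_ && _).
  apply/andP/constant_onP => [[/constant_onP kA /eqP ku] b c|kA].
    have kc x : x \in u |: A -> k x = k a0.
      by rewrite !inE => /orP[/eqP->|xA] //; exact: kA.
    by move=> /kc-> /kc->.
  split.
    apply/constant_onP => b c bA cA; apply: kA;
      by rewrite !inE ?bA ?cA orbT.
  by apply/eqP/kA; rewrite !inE ?eqxx ?a0A ?orbT.
have e'A : {in A &, forall x v, ~~ e' x v}.
  by move=> x v xA vA; rewrite /= negb_and eA.
have e'uA : {in u |: A &, forall x v, ~~ e' x v}.
  move=> x v; rewrite !inE /= => /orP[/eqP->|xA] /orP[/eqP->|vA].
  - by rewrite ei.
  - by rewrite eqxx vA orbT andbF.
  - by rewrite eqxx xA andbF.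
  - by rewrite negb_and eA.
have a0uA : a0 \in u |: A by rewrite !inE a0A orbT.
have [h0 _] := IH A e' e'm e's e'i a0A e'A.
have [g0 g1] := IH (u |: A) e' e'm e's e'i a0uA e'uA.
have -> : (-1) ^+ #|A|.+1 * weight A e =
   (-1) ^+ #|A|.+1 * weight A e' + (-1) ^+ #|u |: A|.+1 * weight (u |: A) e'.
  rewrite E cardsU1 uA add1n mulrBr; congr (_ + _).
  by rewrite [in RHS]exprS mulN1r mulNr.
split=> [|conn]; first exact: addr_ge0.
apply: ltr_wpDl => //; apply: g1 => B sB BT.
have uB : u \in B by apply: (fintype.subsetP sB); rewrite !inE eqxx.
have AB : A \subset B by apply: fintype.subset_trans sB; exact: finset.subsetUr.
have [x [v [xB vB exv]]] := conn B AB BT.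
exists x, v; split=> //=; rewrite exv /= negb_or !negb_and.
have -> : v != u by apply: contra vB => /eqP ->.
have -> : v \notin A by apply: contra vB => /(fintype.subsetP AB).
by rewrite !orbT.
Qed.

(** The sum is [X_G] evaluated at the letters [z c]. Among the power sum products
    only [p_n] does not vanish there, and its coefficient in [X_G] is nonzero of
    sign [(-1) ^+ n.-1] exactly because the graph is connected. *)
Lemma proper_colouring_sum_gt0 (e : rel V) v0 :
    symmetric e -> irreflexive e ->
    (forall B : {set V}, v0 \in B -> B != [set: V] ->
      exists x y, [/\ x \in B, y \notin B & e x y]) ->
  0 < \sum_(k : {ffun V -> C} | properb e k) \prod_v z (k v).
Proof.
move=> es ei conn.
have e0 : {in [set v0] &, forall a b, ~~ e a b}.
  by move=> a b; rewrite !inE => /eqP-> /eqP->; rewrite ei.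
have [_] := signed_weight_pos (leqnn _) es ei (set11 v0) e0.
rewrite cards1 sqrrN expr1n mul1r => pos.
rewrite (eq_bigl (fun k : {ffun V -> C} =>
  constant_on [set v0] k && properb e k)).
  by apply: pos => B; rewrite finset.sub1set; exact: conn.
move=> k; rewrite andb_idl // => _; apply/constant_onP => a b.
by rewrite !inE => /eqP-> /eqP->.
Qed.

End RootOfUnityColourings.

(** * Elementary symmetric polynomials at roots of unity *)

(** With [d] constantly [1] this is the generating function of the elementary
    symmetric polynomials; with [d] the block sizes it describes their values at
    blocks of roots of unity. *)
Lemma coef_prod_binomials (A : comNzRingType) (I : finType) (x : I -> A)
    (d : I -> nat) (j : nat) :
  (\prod_i (1 + (x i)%:P * 'X^(d i)))`_j =
  \sum_(J : {set I} | (\sum_(i in J) d i)%N == j) \prod_(i in J) x i.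
Proof.
under eq_bigr do rewrite addrC.
rewrite bigA_distr coef_sum [RHS]big_mkcond; apply: eq_bigr => J _ /=.
rewrite -(big_mkcond (fun i => i \in J)) big_split /= -rmorph_prod prodrXr.
by rewrite coefCM coefXn eq_sym; case: eqP => _; rewrite ?mulr1 ?mulr0.
Qed.

(** Substitute [- eta * 'X] in the factorization of ['X^k - 1] over the powers of
    the inverse root; the sign condition on [eta ^+ k] makes the result
    [- (1 + 'X^k)], and the constant factors are compared at [0]. *)
Lemma prod_one_add_root (k : nat) (eta zeta : algC) :
    (0 < k)%N -> k.-primitive_root zeta -> eta ^+ k = (-1) ^+ k.+1 ->
  \prod_(a < k) (1 + (eta * zeta ^+ a)%:P * 'X) = 1 + 'X^k :> {poly algC}.
Proof.
move=> k_gt0 zP etak.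
have z0 : zeta != 0 by rewrite (prim_root_eq0 zP) -lt0n.
have zVP : k.-primitive_root zeta^-1.
  have -> : zeta^-1 = zeta ^+ k.-1.
    by apply: (mulfI z0); rewrite mulfV // -exprS prednK // prim_expr_order.
  by rewrite prim_root_exp_coprime // coprimePn.
have := congr1 (comp_poly ((- eta)%:P * 'X)) (factor_Xn_sub_1 zVP).
rewrite big_mkord rmorph_prod /= rmorphB rmorph1 /= rmorphXn /=.
rewrite comp_polyX exprMn -rmorphXn /= exprNn etak exprS mulrCA -expr2.
rewrite sqrr_sign mulr1.
rewrite [(-1)%:P]polyCN mulN1r -opprD [_ + 1]addrC => E.
pose c := \prod_(a < k) - (zeta^-1 ^+ a).
have F : c%:P * \prod_(a < k) (1 + (eta * zeta ^+ a)%:P * 'X) = - (1 + 'X^k).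
  rewrite -E rmorph_prod -big_split /=; apply: eq_bigr => a _.
  rewrite rmorphB /= comp_polyX comp_polyC mulrDr mulr1 mulrA -polyCM addrC.
  congr (_ * _ + _); last by rewrite polyCN.
  by congr _%:P; rewrite mulNr mulrCA -exprMn mulVf // expr1n mulr1.
have := congr1 (fun p => p.[0]) F; rewrite /= hornerM horner_prod.
rewrite hornerN hornerD hornerXn !hornerC expr0n gtn_eqF // addr0.
rewrite [X in _ * X]big1 ?mulr1 => [c1|a _]; last by rewrite !hornerE.
by move: F; rewrite c1 polyCN polyC1 mulN1r => /oppr_inj.
Qed.

Lemma prod_one_add_root_scaled (A : comNzRingType) (h : {rmorphism algC -> A})
    (t : A) (k : nat) (eta zeta : algC) :
    (0 < k)%N -> k.-primitive_root zeta -> eta ^+ k = (-1) ^+ k.+1 ->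
  \prod_(a < k) (1 + (h (eta * zeta ^+ a) * t)%:P * 'X) =
  1 + (t ^+ k)%:P * 'X^k.
Proof.
move=> k_gt0 zetaP etaP.
have := congr1 (fun p => map_poly h p \Po (t%:P * 'X))
  (prod_one_add_root k_gt0 zetaP etaP).
rewrite /= !rmorph_prod /= rmorphD rmorph1 /= rmorphD /= rmorph1 /=.
rewrite map_polyXn rmorphXn /= comp_polyX exprMn -rmorphXn /= => <-.
apply: eq_bigr => a _; rewrite rmorphD rmorph1 /= rmorphD rmorph1 /=.
rewrite [map_poly h _]rmorphM /= map_polyC map_polyX [_ \Po _]rmorphM /=.
by rewrite comp_polyC comp_polyX mulrA -polyCM.
Qed.

Section MonomialAlgebra.
Variables (K : monomType) (R : comNzRingType).

Lemma monalgU_M (a b : R) (m1 m2 : K) :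
  << a *g m1 >> * << b *g m2 >> = << a * b *g mmul m1 m2 >> :> {malg R[K]}.
Proof. by rewrite malgM_def fgmulUU. Qed.

Lemma monalgU_prod (I : Type) (r : seq I) (P : pred I) (a : I -> R)
    (f : I -> K) :
  \prod_(i <- r | P i) << a i *g f i >> =
  << \prod_(i <- r | P i) a i *g \big[mmul/mone]_(i <- r | P i) f i >>
    :> {malg R[K]}.
Proof.
elim: r => [|i r IH]; first by rewrite !big_nil.
by rewrite !big_cons; case: ifP => // _; rewrite IH monalgU_M.
Qed.

Lemma mcoeff_sum (I : Type) (r : seq I) (P : pred I) (F : I -> {malg R[K]}) m :
  (\sum_(i <- r | P i) F i)@_m = \sum_(i <- r | P i) (F i)@_m.
Proof. exact: raddf_sum. Qed.

End MonomialAlgebra.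

Lemma cmonom_prodE (J : choiceType) (I : Type) (r : seq I) (P : pred I)
    (f : I -> {cmonom J}) (j : J) :
  (\big[mmul/mone]_(i <- r | P i) f i) j = (\sum_(i <- r | P i) f i j)%N.
Proof. exact: (big_morph (fun m : {cmonom J} => m j) (cmM j) (cm1 j)). Qed.

Section Alphabet.

Variables (l : nat) (mu : 'I_l -> nat).
Hypothesis mu_gt0 : forall i, (0 < mu i)%N.

Definition colour : finType := {i : 'I_l & 'I_(mu i)}.

Local Notation ring := {malg algC[{cmonom 'I_l}]}.

Definition zeta (i : 'I_l) : algC := projT1 (C_prim_root_exists (mu_gt0 i)).

Lemma zetaP i : (mu i).-primitive_root (zeta i).
Proof. exact: projT2 (C_prim_root_exists (mu_gt0 i)). Qed.

(** This twist makes the product of the [1 + eta i * zeta i ^+ a *: 'X] equal to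
    [1 + 'X^(mu i)] instead of [1 - (- 'X)^(mu i)], so that the elementary
    symmetric polynomials get nonnegative coefficients without sign bookkeeping. *)
Definition eta (i : 'I_l) : algC := (mu i).-root ((-1) ^+ (mu i).+1).

Lemma etaP i : eta i ^+ mu i = (-1) ^+ (mu i).+1.
Proof. exact: rootCK. Qed.

Definition colour_root (c : colour) : algC :=
  eta (tag c) * zeta (tag c) ^+ tagged c.

Definition rotate (c : colour) : colour :=
  Tagged (fun i => 'I_(mu i)) (ordS (tagged c)).

Lemma rotate_inj : injective rotate.
Proof.
apply: (can_inj
  (g := fun c => Tagged (fun i => 'I_(mu i)) (ord_pred (tagged c)))).
by case=> i a; rewrite /rotate /= ordSK.
Qed.

Lemma colour_root_rotate c :
  colour_root (rotate c) = zeta (tag c) * colour_root c.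
Proof.
rewrite /colour_root /= mulrCA -exprS; congr (_ * _).
by rewrite (prim_expr_mod (zetaP (tag c))).
Qed.

Lemma colour_root_pow c : colour_root c ^+ mu (tag c) = (-1) ^+ (mu (tag c)).+1.
Proof.
rewrite /colour_root exprMn etaP exprAC (prim_expr_order (zetaP _)) expr1n.
by rewrite mulr1.
Qed.

Lemma zeta_neq1 i j : (0 < j < mu i)%N -> zeta i ^+ j != 1.
Proof.
case/andP=> j_gt0 jmu; rewrite -(prim_order_dvd (zetaP i)).
by rewrite gtnNdvd.
Qed.

(** The variable of the block records how many vertices use its colours. *)
Definition letter (c : colour) : ring :=
  << colour_root c *g ucm (tag c) >>.

Definition block_monomial (J : {set 'I_l}) : {cmonom 'I_l} :=
  \big[mmul/mone]_(i in J) iter (mu i) (mmul (ucm i)) mone.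

Lemma block_monomialE J i : block_monomial J i = ((i \in J) * mu i)%N.
Proof.
have E j n : (iter n (mmul (ucm j)) mone : {cmonom 'I_l}) i = (n * (j == i))%N.
  elim: n => [|n IH]; first by rewrite cm1.
  by rewrite iterS cmM IH cmU mulSn.
rewrite /block_monomial cmonom_prodE.
under eq_bigr do rewrite E.
have [iJ|iJ] := boolP (i \in J).
  rewrite (bigD1 i) //= eqxx muln1 big1 ?addn0 ?mul1n // => j /andP[_ /negbTE->].
  by rewrite muln0.
by rewrite big1 // => j jJ; case: eqP iJ jJ => [->/negbTE->|]; rewrite ?muln0.
Qed.

Lemma pow_variable i :
  << ucm i >> ^+ mu i = << iter (mu i) (mmul (ucm i)) mone >> :> ring.
Proof.
elim: (mu i) => [|n IH]; first by rewrite expr0 -mpolyC1E.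
rewrite iterS exprS IH monalgU_M mulr1; reflexivity.
Qed.

Lemma prod_letters :
  \prod_c (1 + (letter c)%:P * 'X^1) =
  \prod_i (1 + (<< ucm i >> ^+ mu i)%:P * 'X^(mu i)) :> {poly ring}.
Proof.
transitivity (\prod_i \prod_(a < mu i)
    (1 + (letter (Tagged (fun i => 'I_(mu i)) a))%:P * 'X^1) : {poly ring}).
  by rewrite sig_big_dep; apply: eq_bigr => -[].
apply: eq_bigr => i _.
rewrite -(prod_one_add_root_scaled (@malgC {cmonom 'I_l} algC) << ucm i >>
  (mu_gt0 i) (zetaP i) (etaP i)).
by apply: eq_bigr => a _; rewrite expr1 monalgU_M mul1m mulr1.
Qed.

Definition elem_letters (j : nat) : ring :=
  \sum_(J : {set colour} | #|J| == j) \prod_(c in J) letter c.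

(** Within a block all elementary symmetric polynomials cancel except the first
    and the last, so a term of the result selects whole blocks. *)
Lemma elem_lettersE j :
  elem_letters j =
  \sum_(J : {set 'I_l} | (\sum_(i in J) mu i)%N == j) << block_monomial J >>.
Proof.
have := congr1 (fun p : {poly ring} => p`_j) prod_letters.
rewrite /= (coef_prod_binomials letter (fun=> 1%N)) coef_prod_binomials => E.
transitivity (\sum_(J : {set colour} | (\sum_(c in J) 1)%N == j)
    \prod_(c in J) letter c).
  by apply: eq_bigl => J; rewrite sum1_card.
rewrite E; apply: eq_bigr => J _.
transitivity (\prod_(i in J) << iter (mu i) (mmul (ucm i)) mone >> : ring).
  by apply: eq_bigr => i _; exact: pow_variable.
by rewrite monalgU_prod big1_eq.
Qed.

Let top : {cmonom 'I_l} := block_monomial [set: 'I_l].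

Lemma coef_elem_ge0 (la : seq nat) m : 0 <= (\prod_(j <- la) elem_letters j)@_m.
Proof.
move: m; apply: (big_ind (fun x : ring => forall m, 0 <= x@_m))
  => [m|x y x0 y0 m|j _ m].
- by rewrite mcoeff1 ler0n.
- rewrite mcoeffMl; apply: sumr_ge0 => m1 _; apply: sumr_ge0 => m2 _.
  by rewrite mulrn_wge0 // mulr_ge0.
rewrite elem_lettersE mcoeff_sum; apply: sumr_ge0 => J _.
by rewrite mcoeffU1 ler0n.
Qed.

Lemma coef_elem_top_gt0 (n : nat) : (\sum_i mu i)%N = n ->
  0 < (\prod_(j <- [:: n]) elem_letters j)@_top.
Proof.
move=> mun; rewrite big_seq1 elem_lettersE (bigD1 [set: 'I_l]); last first.
  by rewrite -mun; apply/eqP; apply: eq_bigl => i; rewrite inE.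
rewrite mcoeffD mcoeffUU ltr_wpDr ?ltr01 // mcoeff_sum; apply: sumr_ge0 => J _.
by rewrite mcoeffU1 ler0n.
Qed.

(** Extracting the monomial in which every block has full exponent selects the
    colourings that use the colours of block [i] exactly [mu i] times. *)
Lemma coef_chromatic (V : finType) (e : rel V) :
  (\sum_(k : {ffun V -> colour} | properb e k) \prod_v letter (k v))@_top =
  \sum_(k : {ffun V -> colour} | properb e k &&
      [forall i, #|[set v | tag (k v) == i]%SET| == mu i])
    \prod_v colour_root (k v).
Proof.
rewrite mcoeff_sum [RHS]big_mkcondr; apply: eq_bigr => k _ /=.
rewrite monalgU_prod mcoeffU.
have contentE i : (\big[mmul/mone]_v ucm (tag (k v)) : {cmonom 'I_l}) i =
    #|[set v | tag (k v) == i]%SET|.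
  rewrite cmonom_prodE -sum1_card [RHS]big_mkcond /=; apply: eq_bigr => v _.
  by rewrite cmU inE; case: eqP.
have -> : (\big[mmul/mone]_v ucm (tag (k v)) == top) =
    [forall i, #|[set v | tag (k v) == i]%SET| == mu i].
  by apply/cmP/'forall_eqP => H i; have := H i;
    rewrite contentE /top block_monomialE inE mul1n.
by case: ifP.
Qed.

End Alphabet.

(** * Connected partitions of e-positive graphs *)

Definition edge_across (V : finType) (e : rel V) (B D : {set V}) : Prop :=
  exists x y, [/\ x \in B, y \in D & e x y].

(** Connectedness of the subgraph induced on [D], in the form in which it is used:
    every proper nonempty part of [D] is joined to the rest of [D]. *)
Definition cut_connected (V : finType) (e : rel V) (D : {set V}) : Prop :=
  forall B : {set V}, B \subset D -> B != finset.set0 -> B != D ->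
    edge_across e B (D :\: B).

Definition balanced (V : finType) (l : nat) (mu : 'I_l -> nat)
    (e : rel V) (k : {ffun V -> colour mu}) : bool :=
  properb e k && [forall i, #|[set v | tag (k v) == i]%SET| == mu i].

Lemma balanced_sum_elem (G : sgraph) (S : seq (seq nat)) (c : seq nat -> rat)
    (l : nat) (mu : 'I_l -> nat) (mu_gt0 : forall i, (0 < mu i)%N) :
    (forall m, chromatic_fps G m = \sum_(la <- S) c la * elem_part_fps la m) ->
  \sum_(k : {ffun G -> colour mu} | balanced adj k)
     \prod_v colour_root mu_gt0 (k v) =
  \sum_(la <- S) ratr (c la) *
    (\prod_(j <- la) elem_letters mu_gt0 j)@_(block_monomial mu [set: 'I_l]).
Proof.
move=> GE; rewrite /balanced -coef_chromatic.
pose iota : {rmorphism rat -> {malg algC[{cmonom 'I_l}]}} :=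
  (@malgC {cmonom 'I_l} algC \o ratr).
rewrite (chromatic_elem_specialization iota (letter mu_gt0) GE) mcoeff_sum.
by apply: eq_bigr => la _; rewrite mcoeffCM.
Qed.

(** With a single block of size [n], every elementary symmetric polynomial other
    than the one of degree [n] (and the one of degree [0]) vanishes, and degrees
    then leave room for one factor only. *)
Lemma coef_elem_one_block (n : nat) (mu_gt0 : forall i : 'I_1, (0 < n)%N)
    (la : seq nat) : 0%N \notin la ->
    (\prod_(j <- la) elem_letters mu_gt0 j)@_(block_monomial (fun=> n)
      [set: 'I_1]) != 0 ->
  la = [:: n].
Proof.
pose top := block_monomial (fun=> n) [set: 'I_1].
have n_gt0 := mu_gt0 ord0.
have elemE j : j != 0%N ->
    elem_letters mu_gt0 j = if j == n then << top >> else 0.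
  move=> j0; rewrite elem_lettersE.
  have full (J : {set 'I_1}) :
      (\sum_(i in J) n)%N = j -> J = [set: 'I_1] /\ j = n.
    move=> Jj; have JT : J = [set: 'I_1].
      apply/setP => i; rewrite inE; apply: contraTT isT => iJ.
      case/eqP: j0; rewrite -Jj big1 // => i' i'J.
      by move: iJ; rewrite (ord1 i) -(ord1 i') i'J.
    by split=> //; rewrite -Jj JT sum_nat_const cardsT card_ord mul1n.
  case: eqP => [jn|jn]; last by rewrite big1 // => J /eqP /full[].
  rewrite (big_pred1 [set: 'I_1]) // => J; apply/eqP/eqP => [/full[]|->] //.
  by rewrite sum_nat_const cardsT card_ord mul1n.
move=> la0.
have [/allP lan|] := boolP (all (pred1 n) la); last first.
  case/allPn=> j jla /= jn; rewrite (big_rem j) //= elemE; last first.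
    by apply: contraNneq la0 => <-.
  by rewrite (negbTE jn) mul0r mcoeff0 eqxx.
have {lan} laE : la = nseq (size la) n by apply/all_pred1P/allP.
rewrite (eq_big_seq (fun=> << top >>)) => [|j jla]; last first.
  have -> : j = n by apply/eqP; move: jla; rewrite laE mem_nseq => /andP[].
  by rewrite elemE ?eqxx // -lt0n.
rewrite monalgU_prod mcoeffU; case: cmP => [/(_ ord0)|_]; last by rewrite eqxx.
rewrite cmonom_prodE block_monomialE inE mul1n.
rewrite big_const_seq count_predT iter_addn_0.
move=> E _; rewrite laE; suff -> : size la = 1%N by [].
by apply/eqP; rewrite -(eqn_pmul2l n_gt0) E muln1.
Qed.

(** A single block of size [#|G|] isolates the coefficient of [e_n], and the
    colouring side is positive by connectedness. *)
Lemma e_positive_coef_gt0 (G : sgraph) (v0 : G) (S : seq (seq nat))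
    (c : seq nat -> rat) :
    cut_connected (@adj G) [set: G] -> uniq S ->
    (forall la, la \in S -> is_partition la /\ 0 <= c la) ->
    (forall m, chromatic_fps G m = \sum_(la <- S) c la * elem_part_fps la m) ->
  [:: #|G|] \in S /\ 0 < c [:: #|G|].
Proof.
move=> conn uS Sc GE; set n := #|G|.
have n_gt0 : (0 < n)%N by apply/card_gt0P; exists v0.
pose mu_gt0 (i : 'I_1) := n_gt0.
have pos :
  0 < \sum_(k : {ffun G -> colour (fun _ : 'I_1 => n)} | balanced adj k)
     \prod_v colour_root mu_gt0 (k v).
  rewrite (eq_bigl (fun k : {ffun G -> _} => properb adj k)) => [|k]; last first.
    rewrite /balanced andb_idr // => _; apply/forallP => i.
    apply/eqP; transitivity #|[set: G]|; last exact: cardsT.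
    apply: eq_card => v; rewrite !inE; apply/eqP.
    by rewrite [LHS]ord1 [RHS]ord1.
  apply: (@proper_colouring_sum_gt0 _ _ (@rotate _ _) _ (zeta mu_gt0 ord0)
    _ _ _ _ _ _ v0).
  - exact: rotate_inj.
  - by move=> a; rewrite colour_root_rotate [tag a]ord1.
  - by move=> j jn; apply: zeta_neq1.
  - by move=> a; rewrite (colour_root_pow mu_gt0 a).
  - apply/card_gt0P.
    by exists (existT (fun _ : 'I_1 => 'I_n) ord0 (Ordinal n_gt0)).
  - exact: adj_sym.
  - exact: adj_irrefl.
  - move=> B v0B BT; have [|x [y [xB]]] := conn B (finset.subsetT B) _ BT.
      by apply/set0Pn; exists v0.
    by rewrite !inE andbT => yB xy; exists x, y.
move: pos; rewrite (balanced_sum_elem mu_gt0 GE) => pos.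
have only la : la \in S -> la != [:: n] ->
    (\prod_(j <- la) elem_letters mu_gt0 j)@_(block_monomial (fun=> n)
      [set: 'I_1]) = 0.
  move=> laS; apply: contraNeq => /coef_elem_one_block -> //.
  by have [[]] := Sc la laS.
have nS : [:: n] \in S.
  apply: contraLR pos => nS; rewrite big_seq big1 ?ltxx // => la laS.
  by rewrite only ?mulr0 //; apply: contraNneq nS => <-.
split=> //; rewrite lt_def; have [_ ->] := Sc _ nS; rewrite andbT.
apply: contraTneq pos => c0; rewrite big_seq big1 ?ltxx // => la laS.
have [->|lan] := eqVneq la [:: n]; first by rewrite c0 rmorph0 mul0r.
by rewrite only ?mulr0.
Qed.

(** The contribution of [e_n] keeps the elementary side positive. On the colouring
    side, group the colourings by the block of the colour of each vertex. If some
    block occupies a disconnected set, rotating its colours on a union of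
    components of this set shows that the group contributes [0]; so some
    assignment of blocks has connected fibers only. *)
Lemma e_positive_connected_partition (G : sgraph) (l : nat) (mu : 'I_l -> nat) :
    e_positive G -> cut_connected (@adj G) [set: G] -> (0 < #|G|)%N ->
    (forall i, (0 < mu i)%N) -> (\sum_i mu i)%N = #|G| ->
  exists f : {ffun G -> 'I_l}, forall i,
    #|[set v | f v == i]%SET| = mu i /\
    cut_connected (@adj G) [set v | f v == i]%SET.
Proof.
case=> S [c [uS Sc GE]] conn /card_gt0P[v0 _] mu_gt0 mun; set n := #|G| in mun.
have [nS cn] := e_positive_coef_gt0 v0 conn uS Sc GE.
apply: contrapT => /forallNP nof.
have : 0 < \sum_(k : {ffun G -> colour mu} | balanced adj k)
     \prod_v colour_root mu_gt0 (k v).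
  rewrite (balanced_sum_elem mu_gt0 GE) (bigD1_seq [:: n]) //=.
  apply: ltr_wpDr; last first.
    by rewrite mulr_gt0 ?ltr0q // coef_elem_top_gt0.
  rewrite big_seq_cond; apply: sumr_ge0 => la /andP[laS _].
  have [_ c0] := Sc la laS.
  by rewrite mulr_ge0 ?ler0q // coef_elem_ge0.
rewrite (partition_big
  (fun k : {ffun G -> colour mu} => [ffun v => tag (k v)]) xpredT) //=.
rewrite big1 ?ltxx // => f _.
have [sizes|/forallPn[i fi]] :=
  boolP [forall i, #|[set v | f v == i]%SET| == mu i]; last first.
  rewrite big_pred0 // => k; apply/negbTE; apply: contra fi.
  case/andP=> /andP[_ /forallP/(_ i)/eqP <-] /eqP <-.
  by apply/eqP/eq_card => v; rewrite !inE ffunE.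
have [i [B [Bi B0 BNi noedge]]] : exists i (B : {set G}),
    [/\ B \subset [set v | f v == i], B != finset.set0,
        B != [set v | f v == i]%SET
      & ~ edge_across adj B ([set v | f v == i] :\: B)].
  apply: contrapT => noB; apply: (nof f) => i.
  split; first exact/eqP/(forallP sizes).
  move=> B Bi B0 BNi; apply: contrapT => Bedge; apply: noB.
  by exists i, B.
have Bf v : v \in B -> f v = i.
  by move/(fintype.subsetP Bi); rewrite inE => /eqP.
apply: (sum_recolour_eq0 (s := @rotate _ mu) (B := B) (w := zeta mu_gt0 i)
  (P := fun a : colour mu => tag a == i)).
- exact: rotate_inj.
- by move=> a /eqP ai; rewrite colour_root_rotate ai.
- by move=> k /andP[_ /eqP kf] v /Bf; rewrite -kf ffunE => /eqP.
- move=> k; rewrite /balanced.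
  have tagE v : tag (recolour B (@rotate _ mu) k v) = tag (k v).
    by rewrite ffunE; case: ifP.
  have -> : [ffun v => tag (recolour B (@rotate _ mu) k v)] =
      [ffun v => tag (k v)].
    by apply/ffunP => v; rewrite !ffunE -tagE ffunE.
  apply: andb_id2r => /eqP kf; congr (_ && _); last first.
    apply: eq_forallb => j; congr (_ == _).
    by apply: eq_card => v; rewrite !inE tagE.
  have kE v : tag (k v) = f v by rewrite -kf ffunE.
  apply: (recolour_proper (P := fun a : colour mu => tag a == i)) => //.
    exact: rotate_inj.
    by move=> v /Bf; rewrite -kE => /eqP.
  move=> u v euv; rewrite !kE => uvB; apply/eqP => uvi; apply: noedge.
  move: uvB; case uB: (u \in B); case vB: (v \in B) => // _.
    exists u, v; split=> //; rewrite !inE vB -uvi.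
    by rewrite (Bf _ uB) eqxx.
  exists v, u; split=> //; last by rewrite adj_sym.
  by rewrite !inE uB uvi (Bf _ vB) eqxx.
apply: zeta_neq1; rewrite card_gt0 B0 -(eqP (forallP sizes i)).
by apply: proper_card; rewrite finset.properEneq BNi.
Qed.

(** * Components around a cut vertex *)

(** The hypothesis says that, up to one exception [d], all the elements that are
    not larger than [x] add up to at most [c x]. Remove a largest element [x] of
    [F]: what remains weighs at most [c x], so each further element,
    taken in increasing order, at least doubles the total. *)
Lemma exp_leq_sum (T : finType) (c : T -> nat) (F : {set T}) :
    {in F, forall x, 0 < c x}%N ->
    {in F, forall x, exists d,
      (\sum_(y | (y != d) && (c y <= c x)) c y <= c x)%N} ->
    F != finset.set0 ->
  (2 ^ #|F|.-1 <= \sum_(x in F) c x)%N.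
Proof.
move: {2}#|F| (leqnn #|F|) => m; elim: m F => [|m IH] F Fm c_gt0 cF F0.
  by move: Fm; rewrite leqn0 cards_eq0 (negbTE F0).
have /set0Pn[x0 x0F] := F0.
have [x xF xmax] : exists2 x, x \in F & forall y, y \in F -> (c y <= c x)%N.
  by have [x xF xmax] := arg_maxnP c x0F; exists x.
rewrite (big_setD1 x) //=; have := cardsD1 x F; rewrite xF add1n => cardF.
have [Fx|Fx] := eqVneq (F :\ x) finset.set0.
  by rewrite cardF Fx cards0 big_set0 addn0 expn0 c_gt0.
have FxF y : y \in F :\ x -> y \in F by rewrite !inE => /andP[].
have IHx : (2 ^ #|F :\ x|.-1 <= \sum_(y in F :\ x) c y)%N.
  apply: IH => //; first by rewrite -ltnS -cardF.
    by move=> y /FxF; exact: c_gt0.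
  by move=> y /FxF; exact: cF.
suff le_x : (\sum_(y in F :\ x) c y <= c x)%N.
  have -> : #|F|.-1 = (#|F :\ x|.-1).+1.
    by rewrite cardF /= prednK // card_gt0.
  by rewrite expnS mul2n -addnn leq_add // (leq_trans IHx).
have [d cd] := cF x xF.
have le_sum (P Q : pred T) : (forall y, P y -> Q y) ->
    (\sum_(y | P y) c y <= \sum_(y | Q y) c y)%N.
  move=> PQ; rewrite big_mkcond [leqRHS]big_mkcond; apply: leq_sum => y _.
  by case: ifP => // /PQ ->.
have [dx|dx] := eqVneq d x.
  apply: leq_trans cd; rewrite dx.
  by apply: le_sum => y; rewrite !inE => /andP[-> /xmax].
(* If [d] is not [x], then [x] is itself in the sum: nothing else but [d] fits. *)
have rest0 : (\sum_(y in F :\ x | y != d) c y = 0)%N.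
  apply/eqP; rewrite -leqn0 -(leq_add2l (c x)) addn0; apply: leq_trans cd.
  rewrite [leqRHS](bigD1 x) /=; last by rewrite eq_sym dx leqnn.
  rewrite leq_add2l; apply: le_sum => y.
  by rewrite !inE => /andP[/andP[-> /xmax ->] ->].
have [dF|dF] := boolP (d \in F :\ x).
  by rewrite (bigD1 d) //= rest0 addn0; apply/xmax/FxF.
rewrite (eq_bigl (fun y => (y \in F :\ x) && (y != d))) ?rest0 // => y.
by rewrite andb_idr // => yF; apply: contraNneq dF => <-.
Qed.

Lemma connected_cut_connected (G : sgraph) :
  is_connected G -> cut_connected (@adj G) [set: G].
Proof.
move=> G1 B _ /set0Pn[x xB] BT; apply: contrapT => noedge.
have symG : connect_sym (@adj G) by apply: sym_connect_sym; exact: adj_sym.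
have closedB : closed (@adj G) (mem B).
  apply: (intro_closed symG) => u w uw uB; apply: contrapT => wB.
  by apply: noedge; exists u, w; split=> //; rewrite !inE andbT; exact/negP.
case/negP: BT; apply/eqP/setP => y; rewrite inE -xB.
apply/esym/(closed_connect closedB); rewrite -(root_connect symG).
have /card_le1_eqP one_root := eq_leq G1.
by apply/eqP/one_root; rewrite !inE andbT; exact: roots_root.
Qed.

Section Components.
Variables (G : sgraph) (v : G).
Let H := delete_vertex v.
Let symH : connect_sym (@adj H).
Proof. by apply: sym_connect_sym; exact: adj_sym. Qed.

Let comp (z : H) : H := fingraph.root (@adj H) z.
Let size_comp (r : H) : nat := #|[set z | comp z == r]|.

Let adj_comp (z w : H) : adj z w -> comp z = comp w.
Proof. by move=> zw; apply/eqP; rewrite (root_connect symH) connect1. Qed.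

Let sum_size_comp (P : pred H) :
  (\sum_(r | P r) size_comp r)%N = #|[set z | P (comp z)]|.
Proof.
rewrite -sum1_card [RHS](partition_big comp P) => [|z]; last by rewrite inE.
apply: eq_bigr => r Pr; rewrite /size_comp -sum1_card; apply: eq_bigl => z.
by rewrite !inE andb_idl // => /eqP ->.
Qed.

(** A connected part that avoids [v] stays inside one component of [G - v]. *)
Let partition_comp (l : nat) (f : G -> 'I_l) :
    (forall i, cut_connected (@adj G) [set u | f u == i]) ->
  forall z w : H, f (val z) != f v -> f (val w) = f (val z) -> comp w = comp z.
Proof.
move=> fconn z w zv wz; apply/eqP; apply: contraT => cwz.
pose B : {set G} := [set val t | t : H &
  (f (val t) == f (val z)) && (comp t == comp z)].
have BP t : (val t \in B) = (f (val t) == f (val z)) && (comp t == comp z).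
  by rewrite mem_imset ?inE //; exact: val_inj.
have [|||_ [u [/imsetP[t tB ->] + tu]]] := fconn (f (val z)) B.
- by apply/fintype.subsetP => _ /imsetP[t + ->]; rewrite !inE => /andP[].
- by apply/set0Pn; exists (val z); rewrite BP !eqxx.
- apply/eqP => /setP/(_ (val w)); rewrite BP inE wz eqxx /=.
  by rewrite (negbTE cwz).
rewrite inE => /andP[uB]; rewrite inE => fu.
have uv : u != v.
  by apply: contra zv => /eqP uv; rewrite -(eqP fu); apply/eqP; congr (f _).
have := BP (Sub u uv); rewrite SubK (negbTE uB) fu /=.
move: tB; rewrite inE => /andP[_ /eqP <-].
by rewrite (@adj_comp t (Sub u uv)) ?eqxx.
Qed.

(** Take a connected partition into parts of size [k], one more than the size of
    the component [x], and at most one smaller remainder. A part of size [k] that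
    avoids [v] fits in no component [y] with at most as many vertices as [x], so
    such a [y] lies in the part of [v], except for the component [d] that contains
    the remainder. The part of [v] has at most [k - 1] vertices besides [v]. *)
Lemma e_positive_component_sizes :
  e_positive G -> is_connected G ->
  forall x : H, (0 < size_comp x)%N -> exists d,
    (\sum_(y | (y != d) && (size_comp y <= size_comp x)) size_comp y
      <= size_comp x)%N.
Proof.
move=> Gpos /connected_cut_connected conn x x_gt0.
pose k := (size_comp x).+1; pose n := #|G|.
have n_gt0 : (0 < n)%N by apply/card_gt0P; exists v.
pose q := (n %/ k)%N; pose r := (n %% k)%N.
pose mu (i : 'I_(q + (0 < r))) := if (i < q)%N then k else r.
have mu_gt0 i : (0 < mu i)%N.
  rewrite /mu; case: (ltnP i q) => // qi; rewrite lt0n; apply/eqP => r0.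
  have : (q + (0 < r) <= i)%N by apply: leq_trans qi; rewrite r0 addn0.
  by rewrite leqNgt ltn_ord.
have mu_sum : (\sum_i mu i)%N = n.
  rewrite big_split_ord /= (eq_bigr (fun=> k)) => [|i _]; last first.
    by rewrite /mu /= ltn_ord.
  rewrite [X in (_ + X)%N](eq_bigr (fun=> r)) => [|i _]; last first.
    by rewrite /mu /= ltnNge leq_addr.
  rewrite !sum_nat_const !card_ord [RHS](divn_eq n k); congr addn.
  by rewrite -/r; case: (r) => // r'; rewrite mul1n.
have lastE (i : 'I_(q + (0 < r))) : (q <= i)%N -> i = q :> nat.
  move=> qi; apply/eqP; rewrite eqn_leq qi andbT -ltnS (leq_trans (ltn_ord i)) //.
  by rewrite -[q.+1]addn1 leq_add2l leq_b1.
have [f fP] := e_positive_connected_partition Gpos conn n_gt0 mu_gt0 mu_sum.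
have fconn i := (fP i).2.
have small (z : H) : (size_comp (comp z) <= size_comp x)%N ->
    f (val z) != f v -> (q <= f (val z))%N.
  move=> zx fz; rewrite leqNgt; apply/negP => fzq.
  have : (k <= size_comp (comp z))%N.
    have <- : mu (f (val z)) = k by rewrite /mu fzq.
    rewrite -(fP _).1.
    have <- : #|val @: [set w : H | f (val w) == f (val z)]| =
              #|[set u | f u == f (val z)]|.
      apply: eq_card => u; apply/imsetP/idP => [[w wz ->]|].
        by move: wz; rewrite !inE.
      rewrite inE => fu.
      have uv : u != v.
        by apply: contra fz => /eqP uv; rewrite -(eqP fu); apply/eqP; congr (f _).
      by exists (Sub u uv); rewrite ?inE.
    rewrite card_imset; last exact: val_inj.
    apply: subset_leq_card; apply/fintype.subsetP => w; rewrite !inE => /eqP wz.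
    by apply/eqP; apply: partition_comp fz wz.
  by rewrite leqNgt ltnS zx.
have [d dP] : exists d, forall z : H, (size_comp (comp z) <= size_comp x)%N ->
    comp z != d -> f (val z) = f v.
  have [/existsP[z /andP[zx fz]]|none] :=
    boolP [exists z : H, (size_comp (comp z) <= size_comp x)%N &&
      (f (val z) != f v)].
    exists (comp z) => w wx; apply: contraNeq => fw; apply/eqP.
    apply: (partition_comp fconn) => //; apply: val_inj => /=.
    have := small z zx fz; have := small w wx fw.
    by move=> /lastE -> /lastE ->.
  exists x => z zx _; apply/eqP; move/existsPn: none => /(_ z).
  by rewrite zx /= negbK.
exists d.
have fvk : (#|[set z : H | f (val z) == f v]| <= size_comp x)%N.
  rewrite -ltnS -/k.
  have : (mu (f v) <= k)%N.
    by rewrite /mu; case: ifP => // _; rewrite ltnW // ltn_pmod.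
  apply: leq_trans; rewrite -(fP _).1 (cardsD1 v) inE eqxx add1n ltnS.
  rewrite -(card_imset _ val_inj); apply: subset_leq_card.
  apply/fintype.subsetP => _ /imsetP[z + ->]; rewrite !inE => ->.
  by rewrite (valP z).
rewrite sum_size_comp; apply: leq_trans fvk; apply: subset_leq_card.
by apply/fintype.subsetP => z; rewrite !inE => /andP[zd zx]; rewrite (dP z).
Qed.

Lemma e_positive_exp_components :
  e_positive G -> is_connected G -> (0 < n_components H)%N ->
  (2 ^ (n_components H).-1 < #|G|)%N.
Proof.
move=> Gpos Gconn comps.
pose F : {set H} := [set r | r \in roots (@adj H)].
have FE : #|F| = n_components H.
  by rewrite cardsE; apply: eq_card => r; rewrite !inE andbT.
have F_gt0 r : r \in F -> (0 < size_comp r)%N.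
  by rewrite inE => /eqP rr; apply/card_gt0P; exists r; rewrite inE /comp rr.
have := @exp_leq_sum H size_comp F F_gt0.
rewrite FE => le_sum.
have {}le_sum : (2 ^ (n_components H).-1 <= \sum_(r in F) size_comp r)%N.
  apply: le_sum; last by rewrite -card_gt0 FE.
  by move=> x /F_gt0; exact: e_positive_component_sizes.
apply: leq_ltn_trans le_sum _; rewrite sum_size_comp.
rewrite -(card_imset _ val_inj) [ltnRHS](cardD1 v) inE add1n ltnS.
rewrite subset_leq_card //.
by apply/fintype.subsetP => _ /imsetP[z _ ->]; rewrite !inE (valP z).
Qed.

End Components.

(** Two neighbours of [v] in the same component of [G - v] would close a cycle
    through [v]. *)
Lemma acyclic_degree_le (T : sgraph) (v : T) :
  is_acyclic T -> (degree v <= n_components (delete_vertex v))%N.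
Proof.
move=> acyc; pose H := delete_vertex v.
have symH : connect_sym (@adj H) by apply: sym_connect_sym; exact: adj_sym.
pose N : {set H} := [set z | adj v (val z)].
have -> : degree v = #|N|.
  rewrite -(card_imset _ val_inj); apply: eq_card => u; rewrite inE.
  apply/idP/imsetP => [vu|[z + ->]]; last by rewrite inE.
  have uv : u != v by apply: contraTneq vu => ->; rewrite adj_irrefl.
  by exists (Sub u uv : H); rewrite ?inE.
have rootN : {in N &, injective (fingraph.root (@adj H))}.
  move=> z w; rewrite !inE => vz vw /eqP; rewrite (root_connect symH).
  case/connectP=> p0 /shortenP[p zp up _] wE {p0}.
  apply/eqP; apply: contraT => zw.
  have pathv : path adj (val z) [seq val t | t <- p].
    by rewrite path_map.
  have uniqv : uniq (v :: [seq val t | t <- z :: p]).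
    rewrite cons_uniq map_inj_uniq ?up ?andbT; last exact: val_inj.
    by apply/negP => /mapP[t _ vt]; have := valP t; rewrite /= -vt eqxx.
  have /acyc : ucycle adj (v :: [seq val t | t <- z :: p]).
    by rewrite /ucycle uniqv andbT /= rcons_path vz pathv last_map -wE adj_sym vw.
  by case: p {zp up pathv uniqv} wE zw => //= wz; rewrite wz eqxx.
rewrite -(card_in_imset rootN); apply: subset_leq_card.
by apply/fintype.subsetP => _ /imsetP[z _ ->]; rewrite !inE andbT roots_root.
Qed.

Lemma log2_le_exp (R : realType) (n d : nat) :
  (0 < n)%N -> log2 (n%:R : R) + 1 <= d%:R -> (n <= 2 ^ d.-1)%N.
Proof.
move=> n_gt0 nd; have d_gt0 : (0 < d)%N.
  rewrite -(ltr0n R); apply: lt_le_trans nd; rewrite ltr_wpDl // divr_ge0 //.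
    by rewrite ln_ge0 // ler1n.
  by rewrite ln_ge0 // ler1n.
have ln2_gt0 : 0 < ln (2 : R) by rewrite ln_gt0 // ltr1n.
have : ln (n%:R : R) <= ln (2 ^+ d.-1).
  rewrite lnXn // -[ln 2 *+ _]mulr_natl -ler_pdivrMr // -/(log2 _).
  by rewrite -(lerD2r 1) natr1 prednK.
by rewrite ler_ln ?posrE ?ltr0n ?exprn_gt0 // -natrX ler_nat.
Qed.

Lemma not_e_positive_of_components (R : realType) (G : sgraph) (n d : nat)
    (v : G) :
    #|G| = n -> is_connected G -> (0 < d <= n_components (delete_vertex v))%N ->
    log2 (n%:R : R) + 1 <= d%:R ->
  ~ e_positive G.
Proof.
move=> Gn Gconn /andP[d_gt0 dv] nd Gpos.
have n_gt0 : (0 < n)%N by rewrite -Gn; apply/card_gt0P; exists v.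
have comps_gt0 := leq_trans d_gt0 dv.
have := e_positive_exp_components Gpos Gconn comps_gt0.
rewrite Gn ltnNge (leq_trans (log2_le_exp n_gt0 nd)) // leq_exp2l //.
by rewrite -ltnS !prednK.
Qed.

Theorem theorem34 (R : realType) :
  (forall (G : sgraph) (n d : nat) (v : G),
     #|G| = n -> is_connected G -> is_cut_vertex v ->
     n_components (delete_vertex v) = d -> (3 <= d)%N ->
     log2 (n%:R : R) + 1 <= d%:R ->
     ~ e_positive G) /\
  (forall (T : sgraph) (n d : nat) (v : T),
     #|T| = n -> is_tree T -> degree v = d -> (3 <= d)%N ->
     log2 (n%:R : R) + 1 <= d%:R ->
     ~ e_positive T).
Proof.
split=> [G n d v Gn Gconn _ Gd d3|T n d v Tn [Tconn Tacyc] Td d3] nd.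
  by apply: (not_e_positive_of_components (v := v) Gn Gconn _ nd);
    rewrite Gd leqnn andbT (leq_trans _ d3).
apply: (not_e_positive_of_components (v := v) Tn Tconn _ nd).
by rewrite (leq_trans _ d3) //= -Td; exact: acyclic_degree_le.
Qed.
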